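(* A Heisenberg torus $T$ has a shear in its holonomy if and only if all simple geodesics on $T$ are pairwise disjoint.
   Context: The Heisenberg plane is the $(G,X)$ geometry $(\mathrm{Heis},\mathbb A^2)$ with $\mathrm{Heis}=\left\{\left(\begin{smallmatrix}\pm1&a&c\\0&\pm1&b\\0&0&1\end{smallmatrix}\right):a,b,c\in\mathbb R\right\}$ acting on $\mathbb A^2=\{[x:y:1]\}\subset\mathbb{RP}^2$. A Heisenberg torus is a torus with a $(\mathrm{Heis},\mathbb A^2)$-structure. Its holonomy contains a shear if some element of the image of the holonomy representation does not act on $\mathbb A^2$ as a translation (the holonomy of a Heisenberg torus lies in the unipotent group $\mathrm{Heis}_0$, and an element is a shear when its entry $a$ is nonzero). The geometry inherits the affine connection of $\mathbb A^2$; geodesics on $T$ are (maximal) curves that are straight lines in developed coordinates. A geodesic is simple if it does not intersect itself; ''pairwise disjoint'' means that any two distinct simple geodesics do not intersect. *)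

(* Defs.v *)
(* MathComp world (MathComp-Analysis over an abstract realType). *)
From HB Require Import structures.
From mathcomp Require Import all_boot all_order all_algebra.
From mathcomp Require Import all_classical all_reals all_analysis.
Set Implicit Arguments.
Unset Strict Implicit.
Unset Printing Implicit Defensive.
Import Order.TTheory GRing.Theory Num.Theory.
Import numFieldNormedType.Exports.
Local Open Scope classical_set_scope.
Local Open Scope ring_scope.

Definition heis_mx (R : realType) (s1 s2 : bool) (a b c : R) : 'M[R]_3 :=
  \matrix_(i < 3, j < 3)
    nth 0 (nth [::] [:: [:: (-1) ^+ s1; a;           c];
                        [:: 0;          (-1) ^+ s2;  b];
                        [:: 0;          0;           1]] i) j.

Definition Heis (R : realType) : set 'M[R]_3 :=
  [set g | exists s1 s2 a b c, g = heis_mx s1 s2 a b c].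

(* The affine plane is [R * R], the point [(x, y)] standing for [x : y : 1].
   An element of [Heis] preserves the last homogeneous coordinate. *)
Definition homog (R : realType) (p : R * R) : 'cV[R]_3 :=
  \col_(i < 3) nth 0 [:: p.1; p.2; 1] i.

Definition heis_act (R : realType) (g : 'M[R]_3) (p : R * R) : R * R :=
  ((g *m homog p) 0 0, (g *m homog p) 1 0).

Definition acts_as_translation (R : realType) (g : 'M[R]_3) : Prop :=
  exists v : R * R, forall p, heis_act g p = p + v.

(* A chart is a pair of its domain and a map, meaningful only on the domain. *)
Definition chart (R : realType) (T : topologicalType) : Type :=
  (set T * (T -> R * R))%type.

(* A homeomorphism from an open set of [T] onto an open set of the plane. *)
Definition is_chart (R : realType) (T : topologicalType) (c : chart R T) :=
  [/\ open c.1,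
      {within c.1, continuous c.2},
      set_inj c.1 c.2
    & forall V : set T, open V -> V `<=` c.1 -> open (c.2 @` V)].

Definition heis_atlas (R : realType) (T : topologicalType)
    (A : set (chart R T)) : Prop :=
  [/\ forall c, A c -> is_chart c,
      forall x : T, exists2 c, A c & c.1 x
    & forall c d x, A c -> A d -> c.1 x -> d.1 x ->
        exists2 g, Heis g & \forall y \near x, d.2 y = heis_act g (c.2 y)].

Definition deck (R : realType) (n : int * int) (p : R * R) : R * R :=
  (p.1 + n.1%:~R, p.2 + n.2%:~R).

(* [pi] exhibits [T] as the quotient space R^2 / Z^2; it is then a universal
   covering of the torus [T], with deck group Z^2. *)
Definition torus_covering (R : realType) (T : topologicalType)
    (pi : R * R -> T) : Prop :=
  [/\ continuous pi,
      forall U : set (R * R), open U -> open (pi @` U),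
      forall x : T, exists p, pi p = x
    & forall p q, pi p = pi q <-> exists n, q = deck n p].

Record heis_torus (R : realType) (T : topologicalType) := HeisTorus {
  cover : R * R -> T;
  coverP : torus_covering cover;
  atlas : set (chart R T);
  atlasP : heis_atlas atlas }.

Definition is_developing_map (R : realType) (T : topologicalType)
    (M : heis_torus R T) (dev : R * R -> R * R) : Prop :=
  forall (p : R * R) (c : chart R T), atlas M c -> c.1 (cover M p) ->
    exists2 g, Heis g &
      \forall q \near p, dev q = heis_act g (c.2 (cover M q)).

(* The fundamental group of the torus is the deck group Z^2. *)
Definition is_holonomy (R : realType) (dev : R * R -> R * R)
    (hol : int * int -> 'M[R]_3) : Prop :=
  [/\ forall n, Heis (hol n),
      forall m n, hol (m + n) = hol m *m hol n
    & forall n p, dev (deck n p) = heis_act (hol n) (dev p)].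

(* The holonomy representation is only defined up to conjugation in [Heis]
   (it depends on the choice of a developing map); being a translation is
   invariant under such conjugation. *)
Definition holonomy_contains_shear (R : realType) (T : topologicalType)
    (M : heis_torus R T) : Prop :=
  exists dev hol, [/\ is_developing_map M dev, is_holonomy dev hol
    & exists n, ~ acts_as_translation (hol n)].

(* Affinely parametrized geodesic on an open interval [I]; the values of
   [gam] outside [I] are irrelevant. *)
Definition is_geodesic (R : realType) (T : topologicalType)
    (M : heis_torus R T) (I : set R) (gam : R -> T) : Prop :=
  [/\ open I, is_interval I, I !=set0
    & forall t c, I t -> atlas M c -> c.1 (gam t) ->
        exists p v : R * R, v <> 0 /\
          \forall s \near t, c.1 (gam s) /\ c.2 (gam s) = p + s *: v].

Definition is_maximal_geodesic (R : realType) (T : topologicalType)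
    (M : heis_torus R T) (I : set R) (gam : R -> T) : Prop :=
  is_geodesic M I gam /\
  forall J del, is_geodesic M J del -> I `<=` J ->
    (forall t, I t -> del t = gam t) -> J = I.

(* Either injective, or a closed curve which is injective on one period. *)
Definition simple_curve (R : realType) (T : topologicalType)
    (I : set R) (gam : R -> T) : Prop :=
  set_inj I gam \/
  I = setT /\ exists L : R,
    [/\ 0 < L, forall t, gam (t + L) = gam t & set_inj `[0, L[ gam].

(* Geodesics as unparametrized curves, i.e. subsets of the torus. *)
Definition simple_geodesic (R : realType) (T : topologicalType)
    (M : heis_torus R T) (C : set T) : Prop :=
  exists I gam, [/\ is_maximal_geodesic M I gam, simple_curve I gam
    & C = gam @` I].

(* Main.v *)
Require Import Defs.
From HB Require Import structures.
From mathcomp Require Import all_boot all_order all_algebra.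
From mathcomp Require Import all_classical all_reals all_analysis.
From mathcomp Require Import zify ring lra.
Import Defs.
Set Implicit Arguments.
Unset Strict Implicit.
Unset Printing Implicit Defensive.
Import Order.TTheory GRing.Theory Num.Theory.
Import numFieldNormedType.Exports.
Local Open Scope classical_set_scope.
Local Open Scope ring_scope.

(** Let [dev] be a developing map on the universal cover R^2, with holonomy
    [hol].

    The holonomy is very constrained ([holonomy_shape]). An affine function of
    [dev] is open, so it cannot be invariant up to sign under the deck group: a
    periodic function attains its extrema ([no_periodic_functional]). Since
    the matrices [hol n] commute, a diagonal entry -1 would produce such an
    affine function, and so would the vanishing of all the entries b. Hence all
    [hol n] are unipotent, some b is nonzero, and commutation forces a = k b
    for a single constant k; the holonomy contains a shear exactly when k is
    nonzero.

    Every structure is complete ([dev_bijective]). In the coordinates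
    (x - k y^2 / 2, y) the holonomy acts by translations, so [dev] becomes a
    local homeomorphism that commutes with translations. By compactness its
    local inverses exist on balls of a uniform radius; they define a local
    action of the group R^2 upstairs, which extends to a global action
    ([extend_action]). Its orbits are open, so it is transitive, and it covers
    the free action by translations; thus [dev] is a bijection
    ([equivariant_bijective]). Therefore the torus is the quotient of the
    affine plane by the holonomy, and the maximal geodesics are exactly the
    projections of full straight lines ([maximal_geodesic_straight]).

    If k is nonzero, a holonomy element with b nonzero changes the slope of
    every line that is not horizontal. Such a line crosses its image, so its
    projection is not simple ([simple_horizontal]). Holonomy preserves the
    family of horizontal lines, whence projections of two of them are equal or
    disjoint ([simple_geodesics_disjoint]). If all holonomy elements are
    translations, they form a lattice, and the closed geodesics in the
    directions of the two generators are simple, distinct and meet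
    ([crossing_geodesics]).

    A developing map and its holonomy exist by analytic continuation
    ([developing_exists], [holonomy_exists]); continuation of germs along short
    vectors is again a local action of R^2, and the same extension argument
    turns it into a global one. *)

(** * Extending local additive actions *)

Lemma small_fraction (R : realType) (V : normedModType R) (d : R) (w : V) :
  0 < d ->
  exists N, forall k, (N <= k)%N -> `|(k.+1%:R^-1 : R) *: w| < d.
Proof.
move=> d0; exists (Num.truncn (`|w| / d)).+1 => k Nk.
rewrite normrZ ger0_norm ?invr_ge0 ?ler0n// mulrC ltr_pdivrMr ?ltr0n//.
rewrite mulrC -ltr_pdivrMr//.
apply: lt_le_trans (_ : (Num.truncn (`|w| / d)).+1%:R <= _).
  by apply: truncnS_gt.
by rewrite ler_nat (leq_trans Nk).
Qed.

(** A small vector can be reached in equal steps, all of which stay small. *)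
Lemma iter_small (R : realType) (V : normedModType R) (X : Type) (d : R)
    (phi : V -> X -> X) (w : V) (x : X) (m : nat) :
  (forall u v x, `|u| < d -> `|v| < d -> `|u + v| < d ->
     phi v (phi u x) = phi (u + v) x) ->
  `|(m.+1%:R : R) *: w| < d -> iter m.+1 (phi w) x = phi ((m.+1%:R : R) *: w) x.
Proof.
move=> addphi.
have small k l : (k <= l)%N ->
    `|(l%:R : R) *: w| < d -> `|(k%:R : R) *: w| < d.
  move=> kl; apply: le_lt_trans; rewrite !normrZ ler_wpM2r//.
  by rewrite !ger0_norm ?ler0n// ler_nat.
elim: m => [|m IHm] md; first by rewrite /= scale1r.
rewrite iterS IHm; last by apply: small md.
rewrite addphi; first by rewrite -[X in _ + X]scale1r -scalerDl natr1.
- by apply: small md.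
- by rewrite -[w]scale1r; apply: (small 1%N _ _ md).
- by rewrite -[X in _ + X]scale1r -scalerDl natr1.
Qed.

Lemma iter_commute (X : Type) (f g h : X -> X) (n : nat) (x : X) :
  (forall y, g (f y) = h y) -> (forall y, g (f y) = f (g y)) ->
  iter n g (iter n f x) = iter n h x.
Proof.
move=> gf comm; elim: n => [//|n IHn].
have commn y : iter n g (f y) = f (iter n g y).
  by elim: n {IHn} => [//|n IHn]; rewrite !iterS IHn comm.
by rewrite /= commn IHn gf.
Qed.

(** A vector [w] acts by performing N times the small step [w / N]. Comparing
    with the common refinement into [M * N] steps shows that the result does not
    depend on N, and steps in two directions commute, which gives additivity. *)
Lemma extend_action (R : realType) (V : normedModType R) (X : Type) (d : R)
    (phi : V -> X -> X) : 0 < d ->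
  (forall u v x, `|u| < d -> `|v| < d -> `|u + v| < d ->
     phi v (phi u x) = phi (u + v) x) ->
  exists Phi : V -> X -> X,
    (forall u v x, Phi v (Phi u x) = Phi (u + v) x) /\
    (forall u x, `|u| < d -> Phi u x = phi u x).
Proof.
move=> d0 addphi.
pose psi (k : nat) (w : V) := iter k.+1 (phi ((k.+1%:R^-1 : R) *: w)).
have refine k l w x : `|(k.+1%:R^-1 : R) *: w| < d ->
    psi k w x = psi (k.+1 * l.+1).-1 w x.
  move=> kd; rewrite /psi prednK// iterM; apply: eq_iter => y.
  have E : (k.+1%:R^-1 : R) *: w =
      (l.+1%:R : R) *: (((k.+1 * l.+1)%:R^-1 : R) *: w).
    rewrite scalerA natrM invfM mulrC -mulrA mulVf ?mulr1//.
  by rewrite (iter_small (d := d)) -?E.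
have indep k l w x : `|(k.+1%:R^-1 : R) *: w| < d ->
    `|(l.+1%:R^-1 : R) *: w| < d -> psi k w x = psi l w x.
  by move=> kd ld; rewrite (refine k l)// (refine l k)// mulnC.
have [N HN] := boolp.choice (fun w : V => small_fraction w d0).
exists (fun w => psi (N w) w); split.
  move=> u v x.
  pose K := (N u + N v + N (u + v)%R)%N.
  have Ku : `|(K.+1%:R^-1 : R) *: u| < d.
    by apply: HN; rewrite /K -addnA leq_addr.
  have Kv : `|(K.+1%:R^-1 : R) *: v| < d.
    by apply: HN; rewrite /K addnAC leq_addl.
  have Kuv : `|(K.+1%:R^-1 : R) *: (u + v)| < d.
    by apply: HN; rewrite /K leq_addl.
  rewrite /= (indep _ K u _ (HN _ _ (leqnn _)) Ku).
  rewrite (indep _ K v _ (HN _ _ (leqnn _)) Kv).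
  rewrite (indep _ K (u + v) _ (HN _ _ (leqnn _)) Kuv).
  rewrite scalerDr in Kuv; rewrite /psi scalerDr.
  have step y := addphi _ _ y Ku Kv Kuv.
  have comm y : phi ((K.+1%:R^-1 : R) *: v) (phi ((K.+1%:R^-1 : R) *: u) y)
      = phi ((K.+1%:R^-1 : R) *: u) (phi ((K.+1%:R^-1 : R) *: v) y).
    by rewrite step addphi ?[_ *: v + _]addrC.
  exact: iter_commute.
move=> u x ud.
have u1 : `|(1%:R^-1 : R) *: u| < d by rewrite invr1 scale1r.
by rewrite (indep _ 0 u _ (HN _ _ (leqnn _)) u1) /psi/= invr1 scale1r.
Qed.

Lemma small_induction (R : realType) (V : normedModType R) (d : R)
    (P : V -> Prop) : 0 < d ->
  (forall u, `|u| < d -> P u) -> (forall u v, P u -> P v -> P (u + v)) ->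
  forall w, P w.
Proof.
move=> d0 Psmall Padd w.
have [N HN] := small_fraction w d0.
have -> : w = (N.+1%:R : R) *: ((N.+1%:R^-1 : R) *: w).
  by rewrite scalerA mulfV// scale1r.
move: (_ *: w) (HN N (leqnn _)) => u ud.
elim: N {HN} => [|k IHk]; first by rewrite scale1r; exact: Psmall.
by rewrite -natr1 scalerDl scale1r; apply: Padd => //; exact: Psmall.
Qed.

(** A property that is locally constant on a segment has an open and closed
    truth set there, and segments are connected. The domain [A] keeps the
    hypothesis relative, so that it serves for balls and for intervals. *)
Lemma segment_induction (R : realType) (V : normedModType R) (A : set V)
    (P : V -> Prop) (x y : V) :
  (forall t : R, 0 <= t <= 1 -> A (x + t *: (y - x))) ->
  (forall z, A z -> \forall z' \near z, A z' -> (P z <-> P z')) ->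
  P x -> P y.
Proof.
move=> segA locP Px.
pose g (t : R) : V := x + t *: (y - x).
have cg : continuous g.
  by move=> t; apply: cvgD; [exact: cvg_cst|exact: scalel_continuous].
have loc (t : R) : 0 <= t <= 1 ->
    \forall s \near t, 0 <= s <= 1 -> (P (g t) <-> P (g s)).
  move=> t01.
  have : \forall s \near t, A (g s) -> (P (g t) <-> P (g s)).
    exact: (cg t _ (locP _ (segA _ t01))).
  by apply: filterS => s /= H s01; apply: H; exact: segA.
pose B := [set t : R | `[0, 1]%classic t /\ P (g t)].
have : B = `[0, 1]%classic.
  apply: (@segment_connected R 0 1).
  - exists 0; split; rewrite /= ?in_itv/= ?lexx ?ler01//.
    by rewrite /g scale0r addr0.
  - exists ([set t | 0 <= t <= 1 -> P (g t)]^° ); first exact: open_interior.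
    rewrite predeqE => t; split.
      move=> [/= t01 Pt]; split=> //; rewrite in_itv/= in t01.
      by move: (loc t t01); apply: filterS => s Hs s01; apply/Hs.
    move=> [/= t01 Ht]; split=> //; rewrite in_itv/= in t01.
    exact: (interior_subset Ht).
  - exists (~` [set t | 0 <= t <= 1 -> ~ P (g t)]^° ).
      by apply: open_closedC; exact: open_interior.
    rewrite predeqE => t; split.
      move=> [/= t01 Pt]; split=> // /interior_subset; rewrite in_itv/= in t01.
      by move=> /(_ t01).
    move=> [/= t01 Ht]; split=> //; rewrite in_itv/= in t01.
    apply: contrapT => nP; apply: Ht.
    by move: (loc t t01); apply: filterS => s Hs s01; rewrite -Hs.
move=> E; have : `[0, 1]%classic (1 : R) by rewrite /= in_itv/= ler01 lexx.
by rewrite -E /B /= => -[_]; rewrite /g scale1r addrC subrK.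
Qed.

(** * Functions on the plane that are periodic under the deck group *)

Definition unit_square (R : realType) : set (R * R) :=
  (`[0, 1]%classic : set R) `*` `[0, 1]%classic.

Lemma deck_to_square (R : realType) (p : R * R) :
  exists n, unit_square (deck n p).
Proof.
exists (- Num.floor p.1, - Num.floor p.2).
have H (x : R) : 0 <= x + (- Num.floor x)%:~R <= 1.
  have := floor_le_tmp x; have := floorD1_gt x.
  by rewrite intrD mulrNz /=; lra.
by split; rewrite /= in_itv/= H.
Qed.

Lemma deckK (R : realType) (n : int * int) (p : R * R) : deck (- n) (deck n p) = p.
Proof.
by case: p n => x y [i j]; rewrite /deck/= !mulrNz !addrK.
Qed.

(** The translates of the compact unit square fill the plane, so a scale that
    can be chosen locally can be chosen once and for all. *)
Lemma periodic_uniform (R : realType) (P : R -> R * R -> Prop) :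
  (forall e n p, P e p -> P e (deck n p)) ->
  (forall p, exists2 r, 0 < r & forall q e, `|q - p| < r -> 0 < e < r -> P e q) ->
  exists2 e, 0 < e & forall p, P e p.
Proof.
move=> Pper Ploc.
have : compact (@unit_square R).
  by apply: compact_setX; exact: segment_compact.
move=> /compact_near_coveringP/(_ R 0^'+ (fun e p => P e p)).
case=> [x _|].
  have [r r0 H] := Ploc x.
  exists (ball x r, [set e | 0 < e < r]) => /=; first split.
  - exact: nbhsx_ballx.
  - by near=> e; apply/andP; split; near: e; 
      [exact: nbhs_right_gt|exact: nbhs_right_lt].
  - by move=> [q e] [/= xq e0r]; apply: H => //; rewrite distrC -ball_normE in xq *.
move=> e /= e0 He.
exists (e / 2) ; first by rewrite divr_gt0.
move=> p; have [n Kn] := deck_to_square p.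
rewrite -(deckK n p); apply: Pper; apply: (He (e / 2)) => //=.
  by rewrite sub0r normrN ger0_norm ?ltW ?divr_gt0// ltr_pdivrMr// ltr_pMr// ltr1n.
by rewrite divr_gt0.
Unshelve. all: by end_near. Qed.

(** A periodic function attains its extrema, an open one has none. *)
Lemma no_periodic_open (R : realType) (f : R * R -> R) :
  continuous f -> (forall U, open U -> open (f @` U)) ->
  (forall n p, `|f (deck n p)| = `|f p|) -> False.
Proof.
move=> cf openf perf.
have cK : compact (@unit_square R).
  by apply: compact_setX; exact: segment_compact.
have K0 : @unit_square R !=set0.
  by exists (0, 0); split; rewrite /= in_itv/= lexx ler01.
have [p _ maxp] : exists2 p, p \in @unit_square R &
    forall q, q \in @unit_square R -> `|f q| <= `|f p|.
  apply: (@compact_EVT_max (R * R)%type R (fun p => `|f p|)) => //.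
  apply: continuous_subspaceT => x.
  by apply: (continuous_comp (cf x)); exact: norm_continuous.
have {}maxp q : `|f q| <= `|f p|.
  have [n Kn] := deck_to_square q.
  by rewrite -(perf n q); apply: maxp; rewrite inE.
have := openf _ (openT); rewrite openE => /(_ (f p)) [|e /= e0 He].
  by exists p.
have [q _ fq] : (f @` setT) (f p + (if 0 <= f p then e / 2 else - (e / 2))).
  apply: He => /=.
  rewrite opprD addrA subrr sub0r normrN.
  by case: ifP => _; rewrite ?normrN ger0_norm; lra.
have := maxp q; rewrite fq; case: ifPn; rewrite -?ltNge => f0.
  rewrite !ger0_norm; lra.
rewrite !ltr0_norm; lra.
Qed.

(** * The matrix group and its affine action *)

Lemma heis_actE (R : realType) s1 s2 (a b c : R) (p : R * R) :
  heis_act (heis_mx s1 s2 a b c) p =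
  ((-1) ^+ s1 * p.1 + a * p.2 + c, (-1) ^+ s2 * p.2 + b).
Proof.
by congr pair; rewrite !mxE !big_ord_recl big_ord0 !mxE/= ?mul0r ?add0r ?mulr1 ?addr0 ?addrA.
Qed.

Lemma heis_mxM (R : realType) s1 s2 (a b c : R) t1 t2 (a' b' c' : R) :
  heis_mx s1 s2 a b c *m heis_mx t1 t2 a' b' c' =
  heis_mx (s1 (+) t1) (s2 (+) t2) ((-1) ^+ s1 * a' + a * (-1) ^+ t2)
    ((-1) ^+ s2 * b' + b) ((-1) ^+ s1 * c' + a * b' + c).
Proof.
apply/matrixP => i j; rewrite !mxE !big_ord_recl big_ord0 !mxE/=.
case: i => [[|[|[|i]]] Hi] //; case: j => [[|[|[|j]]] Hj] //=;
  rewrite ?mul0r ?mulr0 ?add0r ?addr0 ?mulr1 ?signr_addb ?addrA//.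
Qed.

Lemma heis_mx_inj (R : realType) s1 s2 (a b c : R) t1 t2 (a' b' c' : R) :
  heis_mx s1 s2 a b c = heis_mx t1 t2 a' b' c' ->
  [/\ (-1) ^+ s1 = (-1) ^+ t1 :> R, (-1) ^+ s2 = (-1) ^+ t2 :> R, a = a', b = b' & c = c'].
Proof.
move=> /matrixP E.
have := E 0 0; have := E 1 1; have := E 0 1; have := E 1 2; have := E 0 2.
by rewrite !mxE.
Qed.

Lemma Heis_mul (R : realType) (g h : 'M[R]_3) : Heis g -> Heis h -> Heis (g *m h).
Proof.
move=> [s1 [s2 [a [b [c ->]]]]] [t1 [t2 [a' [b' [c' ->]]]]].
by rewrite heis_mxM; do 5 eexists.
Qed.

Lemma heis_act_mul (R : realType) (g h : 'M[R]_3) (p : R * R) : Heis h ->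
  heis_act (g *m h) p = heis_act g (heis_act h p).
Proof.
move=> [s1 [s2 [a [b [c ->]]]]].
have E : homog (heis_act (heis_mx s1 s2 a b c) p) = heis_mx s1 s2 a b c *m homog p.
  apply/matrixP => i j; rewrite heis_actE !mxE !big_ord_recl big_ord0 !mxE/=.
  by case: i => [[|[|[|i]]] Hi] //=;
    rewrite ?mul0r ?mulr0 ?add0r ?addr0 ?mulr1 ?addrA.
by rewrite [RHS]/heis_act E mulmxA.
Qed.

Lemma Heis_1 (R : realType) : Heis (1%:M : 'M[R]_3).
Proof.
exists false, false, 0, 0, 0; apply/matrixP => i j; rewrite !mxE.
by case: i => [[|[|[|i]]] Hi] //; case: j => [[|[|[|j]]] Hj].
Qed.

Lemma heis_act1 (R : realType) (p : R * R) : heis_act 1%:M p = p.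
Proof. by rewrite /heis_act mul1mx !mxE; case: p. Qed.

Lemma Heis_inv (R : realType) (g : 'M[R]_3) : Heis g ->
  exists2 h, Heis h & h *m g = 1%:M /\ g *m h = 1%:M.
Proof.
move=> [s1 [s2 [a [b [c ->]]]]].
pose u : R := (-1) ^+ s1; pose v : R := (-1) ^+ s2.
exists (heis_mx s1 s2 (- (u * v * a)) (- (v * b)) (u * v * a * b - u * c)).
  by do 5 eexists.
have u2 : u * u = 1 by rewrite -signr_addb addbb.
have v2 : v * v = 1 by rewrite -signr_addb addbb.
by split; rewrite heis_mxM !addbb -/u -/v; apply/matrixP => i j; rewrite !mxE;
  case: i => [[|[|[|i]]] Hi] //; case: j => [[|[|[|j]]] Hj] //=; ring: u2 v2.
Qed.

Lemma heis_act_inj (R : realType) (g : 'M[R]_3) : Heis g -> injective (heis_act g).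
Proof.
move=> Hg; have [h Hh [hg _]] := Heis_inv Hg.
by move=> p q /(congr1 (heis_act h)); rewrite -!heis_act_mul// hg !heis_act1.
Qed.

Lemma continuous_pair (R : realType) (T : topologicalType) (f g : T -> R) (x : T) :
  {for x, continuous f} -> {for x, continuous g} ->
  {for x, continuous (fun y => (f y, g y))}.
Proof. by move=> cf cg; exact: (cvg_pair cf cg). Qed.

Lemma continuous_affine (R : realType) (T : topologicalType) (f g : T -> R)
    (x : T) (u v w : R) :
  {for x, continuous f} -> {for x, continuous g} ->
  {for x, continuous (fun y => u * f y + v * g y + w)}.
Proof.
move=> cf cg.
have cc (k : R) : {for x, continuous (fun _ : T => k)} by exact: cvg_cst.
exact: (continuousD (continuousD (continuousM (cc u) cf) (continuousM (cc v) cg)) (cc w)).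
Qed.

Lemma heis_act_continuous (R : realType) (g : 'M[R]_3) : Heis g ->
  continuous (heis_act g).
Proof.
move=> [s1 [s2 [a [b [c ->]]]]] p.
rewrite (_ : heis_act _ = fun p => ((-1) ^+ s1 * p.1 + a * p.2 + c,
    0 * p.1 + (-1) ^+ s2 * p.2 + b)); last first.
  by apply/funext => q; rewrite heis_actE mul0r add0r.
have c1 : {for p, continuous (fun q : R * R => q.1)} by exact: cvg_fst.
have c2 : {for p, continuous (fun q : R * R => q.2)} by exact: cvg_snd.
exact: (continuous_pair (continuous_affine c1 c2) (continuous_affine c1 c2)).
Qed.

(** The values at a point and at two small displacements of it along the axes
    determine all the entries. *)
Lemma Heis_eq (R : realType) (g h : 'M[R]_3) (p : R * R) : Heis g -> Heis h ->
  (\forall q \near p, heis_act g q = heis_act h q) -> g = h.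
Proof.
move=> [s1 [s2 [a [b [c ->]]]]] [t1 [t2 [a' [b' [c' ->]]]]].
move=> /nbhs_ballP[r /= r0 H].
have E (u v : R) : `|u| < r -> `|v| < r ->
    (-1) ^+ s1 * (p.1 + u) + a * (p.2 + v) + c = (-1) ^+ t1 * (p.1 + u) + a' * (p.2 + v) + c' /\
    (-1) ^+ s2 * (p.2 + v) + b = (-1) ^+ t2 * (p.2 + v) + b'.
  move=> ur vr.
  have : ball p r (p.1 + u, p.2 + v).
    by split; rewrite /= -ball_normE/= opprD addNKr normrN.
  by move=> /H; rewrite !heis_actE => -[-> ->].
have r2 : `|r / 2| < r by rewrite ger0_norm; lra.
have o : `|0 : R| < r by rewrite normr0.
have [E1 E2] := E _ _ o o.
have [E3 _] := E _ _ r2 o.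
have [E4 E5] := E _ _ o r2.
have e1 : (-1) ^+ s1 = (-1) ^+ t1 :> R.
  by apply: (mulIf (x := r / 2)); lra.
have e2 : (-1) ^+ s2 = (-1) ^+ t2 :> R.
  by apply: (mulIf (x := r / 2)); lra.
have e3 : a = a'.
  by apply: (mulIf (x := r / 2)); lra.
move: E1 E2; rewrite e1 e2 e3 => E1 E2.
have -> : b = b' by lra.
have -> : c = c' by lra.
move: e1 e2 {H E E1 E2 E3 E4 E5}.
by case: s1; case: t1; case: s2; case: t2 => //=; rewrite ?expr0 ?expr1 => *; exfalso; lra.
Qed.

(** * Germs of developing maps *)

(** The local form of [is_developing_map]. *)
Definition developing_on (R : realType) (T : topologicalType)
    (M : heis_torus R T) (U : set (R * R)) (f : R * R -> R * R) : Prop :=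
  forall (p : R * R) (c : chart R T), U p -> atlas M c -> c.1 (cover M p) ->
    exists2 g, Heis g &
      \forall q \near p, f q = heis_act g (c.2 (cover M q)).

Section Developing.
Variables (R : realType) (T : topologicalType) (M : heis_torus R T).
Implicit Types (p q : R * R) (U V : set (R * R)) (f : R * R -> R * R).

Lemma cover_continuous : continuous (cover M).
Proof. by case: (coverP M). Qed.

Lemma cover_deck n p : cover M (deck n p) = cover M p.
Proof. by case: (coverP M) => _ _ _ H; apply/esym/H; exists n. Qed.

Lemma chart_nbhs (c : chart R T) x : atlas M c -> c.1 x -> nbhs x c.1.
Proof.
move=> Mc cx; have [/(_ _ Mc)[oc _ _ _] _ _] := atlasP M.
exact: open_nbhs_nbhs.
Qed.

Lemma chart_near (c : chart R T) p : atlas M c -> c.1 (cover M p) ->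
  \forall q \near p, c.1 (cover M q).
Proof. by move=> Mc cp; apply: cover_continuous; exact: chart_nbhs. Qed.

Lemma atlas_cover p : exists2 c, atlas M c & c.1 (cover M p).
Proof. by have [_ H _] := atlasP M; exact: H. Qed.

Lemma chart_continuous (c : chart R T) x : atlas M c -> c.1 x ->
  {for x, continuous c.2}.
Proof.
move=> Mc cx; have [/(_ _ Mc)[oc cc _ _] _ _] := atlasP M.
by move: cc; rewrite continuous_open_subspace// => /(_ x); apply; rewrite inE.
Qed.

Lemma chart_developing (c : chart R T) : atlas M c ->
  developing_on M (cover M @^-1` c.1) (c.2 \o cover M).
Proof.
move=> Mc p d cp Md dp.
have [_ _ H] := atlasP M; have [g Hg near_g] := H _ _ _ Md Mc dp cp.
by exists g => //; exact: (cover_continuous near_g).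
Qed.

Lemma developing_act U f (g : 'M[R]_3) : Heis g -> developing_on M U f ->
  developing_on M U (fun p => heis_act g (f p)).
Proof.
move=> Hg devf p c Up Mc cp; have [h Hh near_h] := devf p c Up Mc cp.
exists (g *m h); first exact: Heis_mul.
by move: near_h; apply: filterS => q ->; rewrite heis_act_mul.
Qed.

Lemma developing_eq U f1 f2 p : developing_on M U f1 -> developing_on M U f2 ->
  U p -> exists2 g, Heis g & \forall q \near p, f2 q = heis_act g (f1 q).
Proof.
move=> dev1 dev2 Up; have [c Mc cp] := atlas_cover p.
have [g1 Hg1 near1] := dev1 p c Up Mc cp.
have [g2 Hg2 near2] := dev2 p c Up Mc cp.
have [h Hh [hg _]] := Heis_inv Hg1.
exists (g2 *m h); first exact: Heis_mul.
near=> q.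
have -> : f1 q = heis_act g1 (c.2 (cover M q)) by near: q.
have -> : f2 q = heis_act g2 (c.2 (cover M q)) by near: q.
by rewrite heis_act_mul// -(heis_act_mul h)// hg heis_act1.
Unshelve. all: by end_near. Qed.

Lemma developing_continuous U f p : developing_on M U f -> U p ->
  {for p, continuous f}.
Proof.
move=> devf Up; have [c Mc cp] := atlas_cover p.
have [g Hg near_g] := devf p c Up Mc cp.
have C : {for p, continuous (fun q => heis_act g (c.2 (cover M q)))}.
  apply: (@continuous_comp _ _ _ (fun q => c.2 (cover M q)) (heis_act g)).
    apply: (@continuous_comp _ _ _ (cover M) c.2); first exact: cover_continuous.
    exact: chart_continuous.
  exact: heis_act_continuous.
move=> A; rewrite (nbhs_singleton near_g) => nA.
have {}nA : \forall q \near p, A (heis_act g (c.2 (cover M q))) by exact: C.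
change (\forall q \near p, A (f q)).
by near=> q; rewrite (_ : f q = heis_act g (c.2 (cover M q))); near: q.
Unshelve. all: by end_near. Qed.

Lemma heis_act_open (g : 'M[R]_3) p V : Heis g -> nbhs p V ->
  nbhs (heis_act g p) (heis_act g @` V).
Proof.
move=> Hg pV; have [h Hh [hg gh]] := Heis_inv Hg.
have : nbhs (heis_act h (heis_act g p)) V by rewrite -heis_act_mul// hg heis_act1.
move=> nV; have : \forall q \near heis_act g p, V (heis_act h q).
  exact: (heis_act_continuous Hh nV).
apply: filterS => q Vq.
by exists (heis_act h q) => //; rewrite -heis_act_mul// gh heis_act1.
Qed.

Lemma developing_open U f p V : developing_on M U f -> U p -> nbhs p V ->
  nbhs (f p) (f @` V).
Proof.
move=> devf Up pV; have [c Mc cp] := atlas_cover p.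
have [g Hg near_g] := devf p c Up Mc cp.
have : \forall q \near p, [/\ V q, f q = heis_act g (c.2 (cover M q)) & c.1 (cover M q)].
  by near=> q; split; near: q => //; exact: chart_near.
move=> /nbhs_ballP[r /= r0 WV].
pose W := ball p r.
have oW : open W by exact: ball_open.
have Wp : W p by exact: ballxx.
have [_ openpi _ _] := Defs.coverP M.
have [/(_ _ Mc)[_ _ _ openc] _ _] := atlasP M.
have nW : nbhs (c.2 (cover M p)) (c.2 @` (cover M @` W)).
  apply: open_nbhs_nbhs; split; last by exists (cover M p) => //; exists p.
  by apply: openc; [exact: openpi|move=> _ [q /WV[_ _ ?] <-]].
rewrite (nbhs_singleton near_g).
move: (heis_act_open Hg nW); apply: filterS => _ [_ [_ [q /WV[Vq E _] <-] <-] <-].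
by exists q.
Unshelve. all: by end_near. Qed.

(** A deck transformation that moves a point by less than 1 has integral
    components of absolute value less than 1. *)
Lemma deck_inj_ball p q n : `|deck n q - p| < 2^-1 -> `|q - p| < 2^-1 -> deck n q = q.
Proof.
case: p q n => [p1 p2] [q1 q2] [n1 n2]; rewrite /deck !prod_normE /= !gt_max.
rewrite !ltr_norml => /andP[/andP[a1 a2] /andP[a3 a4]] /andP[/andP[b1 b2] /andP[b3 b4]].
have Z (n : int) : -1 < n%:~R :> R -> n%:~R < 1 :> R -> n = 0.
  move=> l u; have : (-1)%:~R < n%:~R :> R by rewrite mulrN1z.
  have : n%:~R < 1%:~R :> R by [].
  by rewrite !ltr_int; lia.
have -> : n1 = 0 by apply: Z; lra.
have -> : n2 = 0 by apply: Z; lra.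
by rewrite !addr0.
Qed.

Lemma cover_inj_ball p q q' : `|q - p| < 2^-1 -> `|q' - p| < 2^-1 ->
  cover M q = cover M q' -> q = q'.
Proof.
have [_ _ _ fib] := Defs.coverP M.
by move=> qp q'p /fib[n E]; move: q'p; rewrite E => q'p; rewrite (deck_inj_ball q'p qp).
Qed.

Lemma developing_inj U f p : developing_on M U f -> U p ->
  exists2 r, 0 < r & forall q q', `|q - p| < r -> `|q' - p| < r ->
    f q = f q' -> q = q'.
Proof.
move=> devf Up; have [c Mc cp] := atlas_cover p.
have [g Hg near_g] := devf p c Up Mc cp.
have : \forall q \near p, f q = heis_act g (c.2 (cover M q)) /\ c.1 (cover M q).
  by near=> q; split; near: q => //; exact: chart_near.
move=> /nbhs_ballP[r /= r0 H].
have [/(_ _ Mc)[_ _ injc _] _ _] := atlasP M.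
exists (Num.min r (2^-1)); first by rewrite lt_min r0 invr_gt0 ltr0n.
move=> q q'; rewrite !lt_min => /andP[qr q2] /andP[q'r q'2].
have bq x : `|x - p| < r -> ball p r x by rewrite -ball_normE /ball_/= distrC.
have [-> cq] := H _ (bq _ qr); have [-> cq'] := H _ (bq _ q'r).
move=> /(heis_act_inj Hg)/injc; rewrite !inE => /(_ cq cq').
exact: (cover_inj_ball q2 q'2).
Unshelve. all: by end_near. Qed.

(** Developing maps are open, so two matrices that agree along one agree on an
    open set of the plane. *)
Lemma developing_germ_uniq U f p (g h : 'M[R]_3) : developing_on M U f -> U p ->
  Heis g -> Heis h -> (\forall q \near p, heis_act g (f q) = heis_act h (f q)) -> g = h.
Proof.
move=> devf Up Hg Hh near_gh; apply: (@Heis_eq _ g h (f p)) => //.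
move: (developing_open devf Up near_gh); apply: filterS => z [q E <-].
exact: E.
Qed.

Definition convex_domain U :=
  forall p q (t : R), U p -> U q -> 0 <= t <= 1 -> U (p + t *: (q - p)).

(** Near each point two developing maps differ by a well-defined matrix, which
    is therefore locally constant. *)
Lemma developing_unique U f1 f2 p q (g : 'M[R]_3) : convex_domain U ->
  developing_on M U f1 -> developing_on M U f2 -> U p -> U q -> Heis g ->
  (\forall x \near p, f2 x = heis_act g (f1 x)) ->
  f2 q = heis_act g (f1 q).
Proof.
move=> convU dev1 dev2 Up Uq Hg near_g.
suff : \forall x \near q, f2 x = heis_act g (f1 x) by move=> /nbhs_singleton.
apply: (@segment_induction R _ U (fun z => \forall x \near z, f2 x = heis_act g (f1 x)) p q) => //.
  by move=> t t01; exact: convU.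
move=> z Uz; have [h Hh near_h] := developing_eq dev1 dev2 Uz.
have uniq z' : U z' -> (\forall x \near z', f2 x = heis_act h (f1 x)) ->
    (\forall x \near z', f2 x = heis_act g (f1 x)) -> g = h.
  move=> Uz' near_h' near_g'; apply: (developing_germ_uniq dev1 Uz') => //.
  by move: near_h' near_g'; apply: filterS2 => x -> ->.
have : \forall z' \near z, \forall x \near z', f2 x = heis_act h (f1 x).
  by apply: near_join.
apply: filterS => z' near_h' Uz'; split => G.
  by rewrite (uniq _ Uz near_h G).
by rewrite (uniq _ Uz' near_h' G).
Qed.

End Developing.

(** * Existence of the developing map and of the holonomy *)

Lemma deckD (R : realType) m n (p : R * R) : deck (m + n) p = deck m (deck n p).
Proof.
by case: p m n => x y [i j] [k l]; rewrite /deck/= !rmorphD/= !addrA; congr pair; ring.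
Qed.

Lemma deck_diff (R : realType) n (p q : R * R) : deck n p - deck n q = p - q.
Proof. by case: p q n => x y [z w] [i j]; rewrite /deck/=; congr pair => /=; ring. Qed.

Lemma deck_continuous (R : realType) n : continuous (@deck R n).
Proof.
move=> p; rewrite (_ : deck n = +%R^~ (n.1%:~R, n.2%:~R)).
  exact: (cvgD cvg_id (cvg_cst _)).
by apply/funext => -[].
Qed.

Section Existence.
Variables (R : realType) (T : topologicalType) (M : heis_torus R T).
Implicit Types (p q u v w : R * R).

Lemma convex_ball p (r : R) : convex_domain [set q | `|q - p| < r].
Proof.
move=> x y t /= xr yr /andP[t0 t1].
have -> : x + t *: (y - x) - p = (1 - t) *: (x - p) + t *: (y - p).
  case: x y p {xr yr} => [x1 x2] [y1 y2] [p1 p2].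
  by congr pair; rewrite /= /GRing.scale/=; ring.
apply: le_lt_trans (ler_normD _ _) _.
rewrite !normrZ !ger0_norm ?subr_ge0//.
have [->|t_neq0] := eqVneq t 0; first by rewrite subr0 mul1r mul0r addr0.
have -> : r = (1 - t) * r + t * r by ring.
apply: ler_ltD; first by rewrite ler_wpM2l ?subr_ge0// ltW.
by rewrite ltr_pM2l// lt_def t_neq0.
Qed.

Lemma near_norm_ball p q (r : R) : `|q - p| < r -> \forall x \near q, `|x - p| < r.
Proof.
move=> qr; have : nbhs q (ball p r).
  apply: open_nbhs_nbhs; split; first by apply: ball_open; exact: le_lt_trans qr.
  by rewrite -ball_normE /= distrC.
by apply: filterS => x; rewrite -ball_normE /= distrC.
Qed.

(** Compactness of a fundamental domain makes the size of the charts uniform. *)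
Lemma uniform_charts : exists2 e : R, 0 < e & forall p, exists2 c, atlas M c &
  forall q, `|q - p| < e -> c.1 (cover M q).
Proof.
apply: periodic_uniform.
  move=> e n p [c Mc H]; exists c => // q qp.
  rewrite -(cover_deck M (- n)); apply: H.
  by rewrite -[p](deckK n) deck_diff.
move=> p; have [c Mc cp] := atlas_cover M p.
have /nbhs_ballP[r /= r0 H] := chart_near Mc cp.
exists (r / 2); first by rewrite divr_gt0.
move=> q e qp /andP[e0 er]; exists c => // x xq; apply: H.
rewrite -ball_normE /= distrC (le_lt_trans (ler_distD q _ _))//; lra.
Qed.

(** Over every ball of a uniform radius [e] a chart gives a developing map
    [d p]. Moving the centre by a vector [w] shorter than [e] multiplies by a
    transition matrix [h (p, w)], and these satisfy a cocycle identity because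
    three nearby balls have a common point. So [w] acts on pairs of a point and
    a matrix; the global action continues the germ at the origin to each point
    along the straight path, independently of how the path is subdivided. *)
Lemma developing_exists : exists dev, is_developing_map M dev.
Proof.
have [e e0 uni] := uniform_charts.
have [c Hc] := boolp.choice (fun p => let: ex_intro2 c Mc H := uni p in
  ex_intro (fun c => atlas M c /\ _) c (conj Mc H)).
pose d p q := (c p).2 (cover M q).
have devd p : developing_on M [set q | `|q - p| < e] (d p).
  move=> q b /= qp; have [Mc H] := Hc p; exact: (chart_developing Mc) (H _ qp).
have transition p w : exists g, `|w| < e -> Heis g /\
    forall q, `|q - p| < e -> `|q - (p + w)| < e -> d p q = heis_act g (d (p + w) q).
  have [we|_] := ltP `|w| e; last by exists 1%:M.
  pose U := [set q | `|q - p| < e] `&` [set q | `|q - (p + w)| < e].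
  have devp : developing_on M U (d p) by move=> q b [qp _]; exact: devd.
  have devpw : developing_on M U (d (p + w)) by move=> q b [_ qp]; exact: devd.
  have Upw : U (p + w) by split; rewrite /= ?subrr ?normr0// addrAC subrr add0r.
  have [g Hg near_g] := developing_eq devpw devp Upw.
  exists g => _; split => // q qp qpw.
  apply: (developing_unique _ devpw devp Upw) => //.
  by move=> x y t [xp xpw] [yp ypw] t01; split; exact: convex_ball.
have [h Hh] := boolp.choice (fun z : (R * R) * (R * R) => transition z.1 z.2).
pose phi w (x : (R * R) * 'M[R]_3) := (x.1 + w, x.2 *m h (x.1, w)).
have addphi u v x : `|u| < e -> `|v| < e -> `|u + v| < e ->
    phi v (phi u x) = phi (u + v) x.
  move=> ue ve uve; rewrite /phi/= addrA -mulmxA; congr (_, _ *m _).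
  have [/= Hu Eu] := Hh (x.1, u) ue.
  have [/= Hv Ev] := Hh (x.1 + u, v) ve.
  have [Huv] := Hh (x.1, u + v) uve.
  rewrite /= addrA => Euv.
  have inb : `|x.1 + u - (x.1 + u + v)| < e by rewrite opprD addNKr normrN.
  apply: (developing_germ_uniq (devd (x.1 + u + v)) inb) => //; first exact: Heis_mul.
  have n1 : \forall q \near x.1 + u, `|q - x.1| < e.
    by apply: near_norm_ball; rewrite addrAC subrr add0r.
  have n2 : \forall q \near x.1 + u, `|q - (x.1 + u)| < e.
    by apply: near_norm_ball; rewrite subrr normr0.
  have n3 := near_norm_ball inb.
  near=> q; rewrite heis_act_mul// -Ev; [|by near: q..].
  rewrite -Eu; [|by near: q..].
  by rewrite -Euv//; near: q.
have [Phi [Phi_add Phi_small]] := extend_action e0 addphi.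
have Phi1 w : forall x, (Phi w x).1 = x.1 + w /\ (Heis x.2 -> Heis (Phi w x).2).
  move: w; apply: (small_induction e0) => [u ue x|u v Pu Pv x].
    by rewrite Phi_small//; split => //= Hx; apply: Heis_mul => //; case: (Hh (x.1, u) ue).
  rewrite -Phi_add; have [E1 H1] := Pu x; have [-> H2] := Pv (Phi u x).
  by rewrite E1 addrA; split => // /H1/H2.
pose G w := (Phi w (0, 1%:M)).2.
have HG w : Heis (G w) by apply: (Phi1 w _).2; exact: Heis_1.
exists (fun w => heis_act (G w) (d w w)).
move=> p b Mb bp.
have pp : `|p - p| < e by rewrite subrr normr0.
have [g Hg near_g] := developing_act (HG p) (devd p) pp Mb bp.
exists g => //; near=> q.
have qp : `|q - p| < e by near: q; exact: near_norm_ball.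
have <- : heis_act (G p) (d p q) = heis_act g (b.2 (cover M q)) by near: q.
have -> : G q = G p *m h (p, q - p).
  have -> : G q = G (p + (q - p)) by rewrite addrC subrK.
  rewrite /G -Phi_add Phi_small// /phi/=.
  by rewrite (Phi1 p _).1 /= add0r.
have [/= Hpq Epq] := Hh (p, q - p) qp.
rewrite heis_act_mul//; congr heis_act.
have E : p + (q - p) = q by rewrite addrC subrK.
by rewrite (Epq q) ?E// subrr normr0.
Unshelve. all: by end_near. Qed.

Lemma developing_deck dev n : is_developing_map M dev ->
  developing_on M setT (fun p => dev (deck n p)).
Proof.
move=> devM p b _ Mb bp.
have bp' : b.1 (cover M (deck n p)) by rewrite cover_deck.
have [g Hg near_g] := devM (deck n p) b Mb bp'.
exists g => //.
have : \forall q \near p, dev (deck n q) = heis_act g (b.2 (cover M (deck n q))).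
  exact: (deck_continuous near_g).
by apply: filterS => q ->; rewrite cover_deck.
Qed.

Lemma developing_onT dev : is_developing_map M dev -> developing_on M setT dev.
Proof. by move=> devM p b _; exact: devM. Qed.

(** Precomposing [dev] with a deck transformation gives another developing map,
    and uniqueness of the matrix that relates the two makes it multiplicative. *)
Lemma holonomy_exists dev : is_developing_map M dev -> exists hol, is_holonomy dev hol.
Proof.
move=> devM; have devT := developing_onT devM.
have eqv n : exists g, Heis g /\ forall p, dev (deck n p) = heis_act g (dev p).
  have devn := developing_deck n devM.
  have [g Hg near_g] := developing_eq devT devn (I : setT (0 : R * R)).
  exists g; split => // p.
  exact: (developing_unique _ devT devn (I : setT (0 : R * R)) (I : setT p) Hg near_g).
have [hol Hhol] := boolp.choice eqv.
exists hol; split => [n|m n|n p]; [by case: (Hhol n)| |by case: (Hhol n)].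
have [[Hm Em] [Hn En] [Hmn Emn]] := And3 (Hhol m) (Hhol n) (Hhol (m + n)).
apply: (developing_germ_uniq devT (I : setT (0 : R * R))) => //; first exact: Heis_mul.
by near=> q; rewrite -Emn deckD Em En heis_act_mul.
Unshelve. all: by end_near. Qed.

End Existence.

(** * Completeness and the shape of the holonomy *)

(** With a uniform radius [e] of injectivity and a uniform radius [d] of the
    balls covered by images, a vector [w] shorter than [d] sends [p] to the point
    of the ball around [p] lying over [D p + w]. This local action extends to an
    action [Phi] of the whole plane over the action by translations. Its orbits
    are open, so there is a single one; then [Phi w 0] determines [w] through
    its image under [D]. *)
Lemma equivariant_bijective (R : realType) (D : R * R -> R * R)
    (tau : int * int -> R * R) :
  continuous D ->
  (forall p V, nbhs p V -> nbhs (D p) (D @` V)) ->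
  (forall p, exists2 r, 0 < r & forall q q', `|q - p| < r -> `|q' - p| < r ->
    D q = D q' -> q = q') ->
  (forall n p, D (deck n p) = D p + tau n) ->
  injective D /\ forall y, exists p, D p = y.
Proof.
move=> cD openD injD eqvD.
have [e1 e10 inj1] : exists2 e, 0 < e & forall p q q',
    `|q - p| < e -> `|q' - p| < e -> D q = D q' -> q = q'.
  apply: periodic_uniform.
    move=> e n p H q q' qp q'p Dqq'.
    apply: (can_inj (@deckK R (- n))); apply: H.
    + by rewrite -[p](deckK n) deck_diff.
    + by rewrite -[p](deckK n) deck_diff.
    + by rewrite !eqvD Dqq'.
  move=> p; have [r r0 H] := injD p.
  exists (r / 2); first by rewrite divr_gt0.
  move=> q e qp /andP[e0 er] x x' xq x'q; apply: H.
    by rewrite (le_lt_trans (ler_distD q _ _))//; lra.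
  by rewrite (le_lt_trans (ler_distD q _ _))//; lra.
pose e := e1 / 2; have e0 : 0 < e by rewrite divr_gt0.
have [d d0 surj] : exists2 d, 0 < d & forall p y,
    `|y - D p| < d -> exists2 q, `|q - p| < e & D q = y.
  apply: periodic_uniform.
    move=> d n p H y yp.
    have [|q qp Dq] := H (y - tau n).
      by move: yp; rewrite eqvD opprD addrA addrAC.
    exists (deck n q); first by rewrite deck_diff.
    by rewrite eqvD Dq subrK.
  move=> p.
  have : nbhs (D p) (D @` ball p (e / 2)).
    by apply: openD; apply: nbhsx_ballx; rewrite divr_gt0.
  move=> /nbhs_ballP[s /= s0 Hs].
  have : \forall q \near p, ball (D p) (s / 2) (D q).
    by apply: cD; apply: nbhsx_ballx; rewrite divr_gt0.
  move=> /nbhs_ballP[r /= r0 Hr].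
  exists (Num.min r (Num.min (s / 2) (e / 2))).
    by rewrite !lt_min r0 !divr_gt0.
  move=> q d; rewrite !lt_min => /andP[qr /andP[_ qe]] /andP[d0 /andP[_ /andP[ds _]]] y yq.
  have Dqp : `|D q - D p| < s / 2.
    have := Hr q; rewrite -!ball_normE/= distrC [`|D p - _|]distrC; exact.
  have [|x xp <-] := Hs y.
    rewrite -ball_normE/= distrC (le_lt_trans (ler_distD (D q) _ _))//; lra.
  exists x => //; move: xp; rewrite -ball_normE/= distrC => xp.
  rewrite (le_lt_trans (ler_distD p _ _))// [`|p - q|]distrC; lra.
have lift w p : exists q, `|w| < d -> `|q - p| < e /\ D q = D p + w.
  have [wd|_] := ltP `|w| d; last by exists p.
  have [|q qp Dq] := surj p (D p + w); first by rewrite addrAC subrr add0r.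
  by exists q.
have [phi Hphi] := boolp.choice (fun z : (R * R) * (R * R) => lift z.1 z.2).
have uniq w p q : `|w| < d -> `|q - p| < e1 -> D q = D p + w -> phi (w, p) = q.
  move=> wd qp Dq; have [/= phip Dphi] := Hphi (w, p) wd.
  apply: (inj1 p) => //; last by rewrite Dphi Dq.
  by rewrite (lt_trans phip)// /e; lra.
have addphi u v x : `|u| < d -> `|v| < d -> `|u + v| < d ->
    phi (v, phi (u, x)) = phi (u + v, x).
  move=> ud vd uvd; apply/esym; apply: uniq => //.
    have [/= ux _] := Hphi (u, x) ud.
    have [/= vx _] := Hphi (v, phi (u, x)) vd.
    rewrite (le_lt_trans (ler_distD (phi (u, x)) _ _))//.
    by rewrite /e in ux vx; lra.
  have [_ ->] := Hphi (v, phi (u, x)) vd.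
  by have [_ /= ->] := Hphi (u, x) ud; rewrite addrA.
have [Phi [Phi_add Phi_small]] := extend_action (phi := fun w p => phi (w, p)) d0 addphi.
have DPhi w : forall p, D (Phi w p) = D p + w.
  move: w; apply: (small_induction d0) => [u ud p|u v Hu Hv p].
    by rewrite Phi_small//; case: (Hphi (u, p) ud).
  by rewrite -Phi_add Hv Hu addrA.
have Phi0 p : Phi 0 p = p.
  by rewrite Phi_small ?normr0//; apply: uniq; rewrite ?normr0 ?subrr ?normr0 ?addr0.
have loc (z : R * R) : \forall z' \near z,
    (exists w, z = Phi w 0) <-> (exists w, z' = Phi w 0).
  have near_e : \forall z' \near z, `|z' - z| < e1.
    by apply: near_norm_ball; rewrite subrr normr0.
  have near_d : \forall z' \near z, ball (D z) d (D z').
    by apply: cD; exact: nbhsx_ballx.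
  move: near_e near_d; apply: filterS2 => z' ze zd.
  have E : z' = Phi (D z' - D z) z.
    move: zd; rewrite -ball_normE /= distrC => zd.
    by rewrite Phi_small//; apply/esym; apply: uniq => //; rewrite addrC subrK.
  split => -[w Ew].
    by exists (w + (D z' - D z)); rewrite -Phi_add -Ew.
  exists (w - (D z' - D z)); rewrite -Phi_add -Ew {2}E Phi_add subrr.
  by rewrite Phi0.
have orbit p : exists w, p = Phi w 0.
  apply: (@segment_induction R _ setT (fun z => exists w, z = Phi w 0) 0) => //.
    by move=> z _; move: (loc z); apply: filterS.
  by exists 0; rewrite Phi0.
split => [p q|y].
  have [u ->] := orbit p; have [v ->] := orbit q.
  by rewrite !DPhi => /addrI ->.
by exists (Phi (y - D 0) 0); rewrite DPhi addrC subrK.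
Qed.

(** The change of coordinates in which all maps
    (x, y) -> (x + k b y + c, y + b) become translations. *)
Definition parabolic_shear (R : realType) (k : R) (p : R * R) : R * R :=
  (p.1 - k / 2 * p.2 ^+ 2, p.2).

Lemma parabolic_shearK (R : realType) (k : R) (p : R * R) :
  parabolic_shear (- k) (parabolic_shear k p) = p.
Proof. by case: p => x y; rewrite /parabolic_shear /=; congr pair; ring. Qed.

Lemma parabolic_shear_continuous (R : realType) (k : R) :
  continuous (@parabolic_shear R k).
Proof.
have H (p : R * R) : {for p, continuous (parabolic_shear k)}.
  have c1 : {for p, continuous (fun q : R * R => q.1)} by exact: cvg_fst.
  have c2 : {for p, continuous (fun q : R * R => q.2)} by exact: cvg_snd.
  have c3 : {for p, continuous (fun q : R * R => 1 * q.1 + (- (k / 2)) * (q.2 * q.2) + 0)}.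
    exact: (continuous_affine c1 (continuousM c2 c2)).
  rewrite (_ : parabolic_shear k =
    fun q : R * R => (1 * q.1 + (- (k / 2)) * (q.2 * q.2) + 0, q.2)).
    exact: (continuous_pair c3 c2).
  by apply/funext => q; rewrite /parabolic_shear mul1r addr0 expr2 mulNr.
exact: H.
Qed.

Lemma parabolic_shear_open (R : realType) (k : R) (p : R * R) (V : set (R * R)) :
  nbhs p V -> nbhs (parabolic_shear k p) (parabolic_shear k @` V).
Proof.
rewrite -{1}[p](parabolic_shearK k) => nV.
have : \forall q \near parabolic_shear k p, V (parabolic_shear (- k) q).
  exact: (parabolic_shear_continuous nV).
apply: filterS => q Vq; exists (parabolic_shear (- k) q) => //.
by rewrite -[k in parabolic_shear k]opprK parabolic_shearK.
Qed.

Section Structure.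
Variables (R : realType) (T : topologicalType) (M : heis_torus R T).
Variables (dev : R * R -> R * R) (hol : int * int -> 'M[R]_3).
Hypotheses (devM : is_developing_map M dev) (holM : is_holonomy dev hol).

Let devT := developing_onT devM.

Lemma dev_continuous : continuous dev.
Proof. by move=> p; exact: (developing_continuous devT (I : setT p)). Qed.

Lemma dev_open p V : nbhs p V -> nbhs (dev p) (dev @` V).
Proof. exact: (developing_open devT). Qed.

(** A nonconstant affine function composed with the open map [dev] is open. *)
Lemma no_periodic_functional (u v w : R) : (u, v) <> 0 ->
  (forall n p, `|u * (dev (deck n p)).1 + v * (dev (deck n p)).2 + w| =
               `|u * (dev p).1 + v * (dev p).2 + w|) -> False.
Proof.
move=> uv0; pose f p := u * (dev p).1 + v * (dev p).2 + w.
apply: (@no_periodic_open R f) => [p|U oU].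
  have c1 : {for p, continuous (fun q => (dev q).1)}.
    by apply: (@continuous_comp _ _ _ dev fst); [exact: dev_continuous|exact: cvg_fst].
  have c2 : {for p, continuous (fun q => (dev q).2)}.
    by apply: (@continuous_comp _ _ _ dev snd); [exact: dev_continuous|exact: cvg_snd].
  exact: (continuous_affine c1 c2).
rewrite openE => _ [p Up <-].
have /dev_open nV : nbhs p U by exact: open_nbhs_nbhs.
pose N := u ^+ 2 + v ^+ 2.
have N0 : N != 0.
  apply/eqP => /eqP; rewrite /N paddr_eq0 ?sqr_ge0// !sqrf_eq0.
  by move=> /andP[/eqP u0 /eqP v0]; apply: uv0; rewrite u0 v0.
(* An affine section of the functional, through the point [dev p]. *)
pose k (y : R) := (u / N * y + 0 * y + ((dev p).1 - u / N * f p),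
   v / N * y + 0 * y + ((dev p).2 - v / N * f p)).
have ck : {for f p, continuous k}.
  have ci : {for f p, continuous (fun y : R => y)} by exact: cvg_id.
  exact: (continuous_pair (continuous_affine ci ci) (continuous_affine ci ci)).
have kfp : k (f p) = dev p.
  by rewrite /k !mul0r !addr0 ![_ + (_ - _)]addrC !subrK; case: (dev p).
rewrite -kfp in nV; have : \forall y \near f p, (dev @` U) (k y) by exact: ck.
apply: filterS => y [q Uq Eq]; exists q => //.
rewrite {1}/f Eq /k /=.
transitivity (f p + (u ^+ 2 + v ^+ 2) / N * (y - f p)); last first.
  by rewrite -/N mulfV// mul1r addrC subrK.
have Ef : f p = u * (dev p).1 + v * (dev p).2 + w by [].
by move: Ef; move: (f p) => F ->; ring.
Qed.

(** If some [hol m] reverses y, every element commuting with it preserves its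
    fixed level [b m / 2], so the distance of y to that level is periodic. Once
    y is never reversed, the same argument applies to any [hol m] that reverses
    x, with the invariant line whose two sides it exchanges. The last relation
    of commutation says that the vectors (a, b) of any two elements are
    proportional. *)
Lemma holonomy_shape : exists (k : R) (b c : int * int -> R),
  (forall n p, heis_act (hol n) p = (p.1 + k * b n * p.2 + c n, p.2 + b n)) /\
  exists n, b n != 0.
Proof.
have [Hhol hol_add eqv] := holM.
have [z Hz] := boolp.choice (fun n => let: ex_intro s1 (ex_intro s2 (ex_intro a
  (ex_intro b (ex_intro c H)))) := Hhol n in
  ex_intro (fun z : bool * bool * R * R * R => hol n =
    heis_mx z.1.1.1.1 z.1.1.1.2 z.1.1.2 z.1.2 z.2) (s1, s2, a, b, c) H).
pose s n : R := (-1) ^+ (z n).1.1.1.1.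
pose t n : R := (-1) ^+ (z n).1.1.1.2.
pose a n := (z n).1.1.2; pose b n := (z n).1.2; pose c n := (z n).2.
have act n p : heis_act (hol n) p = (s n * p.1 + a n * p.2 + c n, t n * p.2 + b n).
  by rewrite Hz heis_actE.
have comm m n : [/\ s m * a n + a m * t n = s n * a m + a n * t m,
    t m * b n + b m = t n * b m + b n
  & s m * c n + a m * b n + c m = s n * c m + a n * b m + c n].
  have : hol m *m hol n = hol n *m hol m by rewrite -!hol_add addrC.
  by rewrite !Hz !heis_mxM => /heis_mx_inj[].
have sgn (x : bool) : (-1) ^+ x = 1 \/ (-1) ^+ x = -1 :> R.
  by case: x; [right|left]; rewrite ?expr1 ?expr0.
have t1 m : t m = 1.
  have [//|tm] : t m = 1 \/ t m = -1 by exact: sgn.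
  exfalso; apply: (@no_periodic_functional 0 1 (- (b m / 2))).
    by case=> /eqP; rewrite oner_eq0.
  move=> n p; rewrite eqv act /=; have [_ E _] := comm m n; rewrite tm in E.
  have [tn|tn] : t n = 1 \/ t n = -1 by exact: sgn.
    by rewrite tn in E *; congr (`|_|); lra.
  by rewrite tn in E *; rewrite -normrN; congr (`|_|); lra.
have s1 m : s m = 1.
  have [//|sm] : s m = 1 \/ s m = -1 by exact: sgn.
  exfalso; apply: (@no_periodic_functional 1 (- (a m / 2)) (- (c m / 2) + a m * b m / 4)).
    by case=> /eqP; rewrite oner_eq0.
  move=> n p; rewrite eqv act /=; have [E _ E'] := comm m n.
  rewrite sm !t1 in E E' *.
  have [sn|sn] : s n = 1 \/ s n = -1 by exact: sgn.
    rewrite sn in E E' *.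
    have an : a n = 0 by lra.
    by rewrite an in E' *; congr (`|_|); lra.
  rewrite sn in E E' *; rewrite -normrN.
  have an : a n = a m by lra.
  by rewrite an in E' *; congr (`|_|); lra.
have [m bm] : exists n, b n != 0.
  apply: contrapT => nb; apply: (@no_periodic_functional 0 1 0).
    by case=> /eqP; rewrite oner_eq0.
  move=> n p; rewrite eqv act /= t1.
  have -> : b n = 0 by apply: contrapT => /eqP bn; apply: nb; exists n.
  by rewrite !mul0r !mul1r !addr0.
(* [a n = k * b n] by commutation with the element [m] that moves y. *)
exists (a m / b m), b, c; split; last by exists m.
move=> n p; rewrite act s1 t1 !mul1r; congr (_ + _ * _ + _, _).
have [_ _] := comm m n; rewrite !s1 => E.
have {}E : a m * b n = a n * b m by lra.
by rewrite mulrAC E mulfK.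
Qed.

Lemma dev_bijective : injective dev /\ forall y, exists p, dev p = y.
Proof.
have [k [b [c [act _]]]] := holonomy_shape.
have [_ _ eqv] := holM.
pose D p := parabolic_shear k (dev p).
have [|p V pV|p|n p|injD surjD] := @equivariant_bijective R D
   (fun n => (c n - k / 2 * b n ^+ 2, b n)).
- move=> p; apply: (@continuous_comp _ _ _ dev); first exact: dev_continuous.
  exact: parabolic_shear_continuous.
- move: (parabolic_shear_open k (dev_open pV)).
  by apply: filterS => _ [_ [q Vq <-] <-]; exists q.
- have [r r0 H] := developing_inj devT (I : setT p); exists r => // q q' qp q'p.
  by move=> /(can_inj (@parabolic_shearK R k)); exact: H.
- by rewrite /D eqv act /parabolic_shear; congr pair => /=; field.
split; first by move=> p q E; apply: injD; rewrite /D E.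
move=> y; have [p Dp] := surjD (parabolic_shear k y).
by exists p; exact: (can_inj (@parabolic_shearK R k)).
Qed.

End Structure.

(** * Geodesics are projections of straight lines *)

Lemma heis_act_line (R : realType) (g : 'M[R]_3) (v : R * R) : Heis g -> v <> 0 ->
  exists2 v', v' <> 0 & forall p (s : R), heis_act g (p + s *: v) = heis_act g p + s *: v'.
Proof.
move=> Hg v0; have [s1 [s2 [a [b [c E]]]]] := Hg.
pose v' : R * R := ((-1) ^+ s1 * v.1 + a * v.2, (-1) ^+ s2 * v.2).
have line p (s : R) : heis_act g (p + s *: v) = heis_act g p + s *: v'.
  by rewrite E !heis_actE /v'; congr pair; rewrite /= /GRing.scale/=; ring.
exists v' => // v'0; apply: v0; apply: (heis_act_inj Hg).
by have := line 0 1; rewrite v'0 scaler0 add0r scale1r addr0.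
Qed.

Lemma line_continuous (R : realType) (p v : R * R) :
  continuous (fun s : R => p + s *: v).
Proof. by move=> s; apply: cvgD; [exact: cvg_cst|exact: scalel_continuous]. Qed.

Lemma line_eq_near (R : realType) (p v q w : R * R) (t : R) :
  (\forall s \near t, p + s *: v = q + s *: w) ->
  forall s : R, p + s *: v = q + s *: w.
Proof.
move=> H; have E := nbhs_singleton H.
have /nbhs_ballP[r /= r0 Hr] := H.
have E2 : p + (t + r / 2) *: v = q + (t + r / 2) *: w.
  by apply: Hr; rewrite -ball_normE /= opprD addNKr normrN ger0_norm; lra.
have {E2} : (r / 2) *: v = (r / 2) *: w.
  by move: E2; rewrite !scalerDl !addrA E => /addrI.
have r2 : r / 2 != 0 by rewrite mulf_neq0 ?invr_neq0 ?pnatr_eq0// gt_eqF.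
move=> /(scalerI r2) vw s; rewrite vw in E *.
by move/addIr : E => ->.
Qed.

Section Geodesics.
Variables (R : realType) (T : topologicalType) (M : heis_torus R T).
Variables (dev : R * R -> R * R) (hol : int * int -> 'M[R]_3).
Hypotheses (devM : is_developing_map M dev) (holM : is_holonomy dev hol).
Variable (E : R * R -> R * R).
Hypotheses (devE : cancel E dev) (Edev : cancel dev E).

Definition straight (p v : R * R) (s : R) : T := cover M (E (p + s *: v)).

Lemma inverse_continuous : continuous E.
Proof.
have H (y : R * R) (A : set (R * R)) : nbhs (E y) A -> \forall z \near y, A (E z).
  move=> nA; rewrite -[y]devE; move: (dev_open devM nA).
  by apply: filterS => _ [q Aq <-]; rewrite Edev.
by move=> y A; exact: H.
Qed.

Lemma lift_continuous (p v : R * R) : continuous (fun s : R => E (p + s *: v)).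
Proof.
move=> s; apply: (@continuous_comp _ _ _ (fun s : R => p + s *: v) E).
  exact: line_continuous.
exact: inverse_continuous.
Qed.

Lemma inverse_hol n y : E (heis_act (hol n) y) = deck n (E y).
Proof. by have [_ _ eqv] := holM; rewrite -[y in LHS]devE -eqv Edev. Qed.

Lemma cover_inverse_eq y z :
  cover M (E y) = cover M (E z) <-> exists n, z = heis_act (hol n) y.
Proof.
have [_ _ _ ->] := Defs.coverP M.
split => -[n H]; exists n; last by rewrite H inverse_hol.
by rewrite -[z]devE H -inverse_hol devE.
Qed.

Lemma straight_geodesic p v : v <> 0 -> is_geodesic M setT (straight p v).
Proof.
move=> v0; split; [exact: openT|by []|by exists 0|].
move=> t c _ Mc ct.
have [g Hg near_g] := devM Mc ct.
have [h Hh [hg _]] := Heis_inv Hg.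
have [v' v'0 line] := heis_act_line Hh v0.
exists (heis_act h p), v'; split => //.
have n1 : \forall s \near t, c.1 (straight p v s).
  exact: (lift_continuous (chart_near Mc ct)).
have n2 : \forall s \near t, dev (E (p + s *: v)) = heis_act g (c.2 (straight p v s)).
  exact: (lift_continuous near_g).
move: n1 n2; apply: filterS2 => s cs; rewrite devE => Es; split => //.
by rewrite -line Es -heis_act_mul// hg heis_act1.
Qed.

(** Two lifts of a curve differ near each point by a single deck
    transformation, as the covering is injective on small balls; the resulting
    identity between affine parametrizations extends to the whole line. *)
Lemma straight_unique p v p' v' (t : R) : v <> 0 ->
  (\forall s \near t, straight p v s = straight p' v' s) ->
  exists n, forall s : R, p' + s *: v' = heis_act (hol n) (p + s *: v).
Proof.
move=> v0 near_eq; have [Hhol _ _] := holM.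
have /cover_inverse_eq[n En] := nbhs_singleton near_eq.
exists n; have [w w0 line] := heis_act_line (Hhol n) v0.
move=> s; rewrite line; apply: (@line_eq_near _ _ _ _ _ t).
have n1 : \forall s \near t, `|E (p' + s *: v') - E (p' + t *: v')| < 2^-1.
  apply: (lift_continuous (near_norm_ball _)).
  by rewrite subrr normr0 invr_gt0 ltr0n.
have n2 : \forall s \near t, `|E (heis_act (hol n) p + s *: w) - E (p' + t *: v')| < 2^-1.
  apply: (lift_continuous (near_norm_ball _)).
  by rewrite -line -En subrr normr0 invr_gt0 ltr0n.
near=> x; apply: (can_inj devE); apply: (@cover_inj_ball _ _ M (E (p' + t *: v'))).
- by near: x.
- by near: x.
- rewrite -line inverse_hol cover_deck; apply/esym.
  by near: x.
Unshelve. all: by end_near. Qed.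

Lemma geodesic_local I gam t : is_geodesic M I gam -> I t ->
  exists p v, v <> 0 /\ \forall s \near t, gam s = straight p v s.
Proof.
move=> [_ _ _ geo] It.
have [_ _ surj _] := Defs.coverP M; have [x xt] := surj (gam t).
have [c Mc cx] := atlas_cover M x.
have ct : c.1 (gam t) by rewrite -xt.
have [p [v [v0 near_line]]] := geo t c It Mc ct.
have [g Hg near_g] := devM Mc cx.
have [w w0 line] := heis_act_line Hg v0.
have Ex : x = E (heis_act g p + t *: w).
  rewrite -[x]Edev (nbhs_singleton near_g) xt -line.
  by have [_ ->] := nbhs_singleton near_line.
exists (heis_act g p), w; split => //.
rewrite Ex in near_g cx.
have n1 : \forall s \near t, c.1 (straight (heis_act g p) w s).
  exact: (lift_continuous (chart_near Mc cx)).
have n2 : \forall s \near t, dev (E (heis_act g p + s *: w)) =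
    heis_act g (c.2 (straight (heis_act g p) w s)).
  exact: (lift_continuous near_g).
have [/(_ _ Mc)[_ _ injc _] _ _] := atlasP M.
near=> s; apply: injc.
- by rewrite inE; apply: (proj1 _); near: s; move: near_line; apply: filterS => ? [].
- by rewrite inE; near: s.
have -> : c.2 (gam s) = p + s *: v.
  by near: s; move: near_line; apply: filterS => ? [].
apply: (heis_act_inj Hg); rewrite line -[LHS]devE.
by near: s.
Unshelve. all: by end_near. Qed.

(** The set of parameters near which a geodesic follows a given projected line
    is open, and it is closed by uniqueness of the line up to holonomy. *)
Lemma geodesic_straight I gam : is_geodesic M I gam ->
  exists p v, v <> 0 /\ forall s, I s -> gam s = straight p v s.
Proof.
move=> geo; have [_ intI [t0 It0] _] := geo.
have [p [v [v0 near0]]] := geodesic_local geo It0.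
exists p, v; split => // s Is.
suff : \forall x \near s, gam x = straight p v x by move=> /nbhs_singleton.
have same p' v' (z : R) : v' <> 0 -> (\forall x \near z, gam x = straight p v x) ->
    (\forall x \near z, gam x = straight p' v' x) ->
    forall x, straight p v x = straight p' v' x.
  move=> v'0 n1 n2.
  have [|n En x] := @straight_unique p v p' v' z v0.
    by move: n1 n2; apply: filterS2 => x <- <-.
  by apply/cover_inverse_eq; exists n.
have loc (z : R) : I z -> \forall z' \near z, I z' ->
    ((\forall x \near z, gam x = straight p v x) <->
     (\forall x \near z', gam x = straight p v x)).
  move=> Iz; have [p' [v' [v'0 near_z]]] := geodesic_local geo Iz.
  have : \forall z' \near z, \forall x \near z', gam x = straight p' v' x.
    exact: near_join.
  apply: filterS => z' near_z' Iz'; split => near_p.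
    have S := same _ _ _ v'0 near_p near_z.
    by move: near_z'; apply: filterS => x ->; rewrite S.
  have S := same _ _ _ v'0 near_p near_z'.
  by move: near_z; apply: filterS => x ->; rewrite S.
apply: (@segment_induction R R^o I (fun z => \forall x \near z, gam x = straight p v x) t0 s) => //.
move=> t /andP[t0_ge t1]; rewrite /GRing.scale/=.
have [st|/ltW ts] := leP t0 s.
  by apply: (intI t0 s) => //; apply/andP; split; nra.
by apply: (intI s t0) => //; apply/andP; split; nra.
Qed.

Lemma maximal_geodesic_straight I gam : is_maximal_geodesic M I gam ->
  exists p v, [/\ v <> 0, I = setT & forall s, gam s = straight p v s].
Proof.
move=> [geo maxI]; have [p [v [v0 H]]] := geodesic_straight geo.
have IT : I = setT.
  apply/esym; apply: (maxI _ (straight p v)) => //; first exact: straight_geodesic.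
  by move=> t It; rewrite H.
by exists p, v; split => // s; apply: H; rewrite IT.
Qed.

Lemma straight_maximal p v : v <> 0 -> is_maximal_geodesic M setT (straight p v).
Proof.
by move=> v0; split; [exact: straight_geodesic|move=> J del _; rewrite subTset].
Qed.

(** * Holonomy with a shear *)

Section Shear.
Variables (k : R) (b c : int * int -> R).
Hypothesis act : forall n p,
  heis_act (hol n) p = (p.1 + k * b n * p.2 + c n, p.2 + b n).
Hypotheses (k0 : k != 0) (b0 : exists n, b n != 0).

(** An element with b nonzero maps a line of direction [v], where v.2 is
    nonzero, to a line of another slope. The two lines meet, at distinct
    parameters because y is translated by b; so the projection is not injective.
    If it were periodic, some element would translate the line along itself,
    and keep its slope. *)
Lemma simple_horizontal p v : v <> 0 -> simple_curve setT (straight p v) -> v.2 = 0.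
Proof.
move=> v0 simple; apply: contrapT => /eqP v20.
have [n bn] := b0.
case: simple => [inj|[_ [L [L0 perL _]]]].
  (* The parameter whose point is sent by [hol n] back to the line; the
     second coordinate forces the image to have parameter [s + b n / v.2]. *)
  pose s := (b n * v.1 / v.2 - c n - k * b n * p.2) / (k * b n * v.2).
  have kbv : k * b n * v.2 != 0 by rewrite !mulf_neq0.
  have : straight p v s = straight p v (s + b n / v.2).
    apply/cover_inverse_eq; exists n; rewrite act.
    congr pair; rewrite /= /GRing.scale/=.
      have : s * (k * b n * v.2) = b n * v.1 / v.2 - c n - k * b n * p.2.
        by rewrite /s divfK.
      move=> Es; have -> : k * b n * (p.2 + s * v.2) =
        k * b n * p.2 + s * (k * b n * v.2) by ring.
      by rewrite Es; ring.
    by field.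
  move=> /inj; rewrite !inE => /(_ I I) /eqP.
  by rewrite -subr_eq0 opprD addNKr oppr_eq0 mulf_eq0 invr_eq0 (negPf bn) (negPf v20).
have [|m Em] := @straight_unique p v (p + L *: v) v 0 v0.
  by near=> x; rewrite -[LHS]perL /straight scalerDl addrA addrAC.
have Em0 := Em 0; have Em1 := Em 1.
rewrite !scale0r !addr0 !scale1r !act in Em0 Em1.
case: Em0 Em1 => e1 e2 [e3 e4].
rewrite /GRing.scale/= in e1 e2 e3 e4.
have bm : b m = L * v.2 by lra.
have : k * b m * v.2 = 0 by lra.
by move=> /eqP; rewrite bm !mulf_eq0 (negPf k0) (negPf v20) (gt_eqF L0).
Unshelve. all: by end_near. Qed.

Lemma simple_geodesic_level C : simple_geodesic M C ->
  exists y : R, C = (fun q => cover M (E q)) @` [set q | q.2 = y].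
Proof.
move=> [I [gam [maxg simple ->]]].
have [p [v [v0 IT Hgam]]] := maximal_geodesic_straight maxg.
have Eg : gam = straight p v by apply/funext.
rewrite IT Eg in simple *.
have v20 := simple_horizontal v0 simple.
have v10 : v.1 != 0.
  by apply/eqP => v10; apply: v0; rewrite [v]surjective_pairing v10 v20.
exists p.2; rewrite eqEsubset; split => _ [s Hs <-] /=.
  by exists (p + s *: v) => //=; rewrite v20 scaler0 addr0.
exists ((s.1 - p.1) / v.1) => //; rewrite /straight; congr (cover M (E _)).
rewrite [s]surjective_pairing; congr pair; rewrite /= /GRing.scale/=.
  by rewrite divfK// addrC subrK.
by rewrite v20 mulr0 addr0 -Hs.
Qed.

Lemma simple_geodesics_disjoint C D : simple_geodesic M C -> simple_geodesic M D ->
  C <> D -> C `&` D = set0.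
Proof.
move=> /simple_geodesic_level[y ->] /simple_geodesic_level[z ->] CD.
apply/eqP; apply: contrapT => /negP/set0P[_ [[q /= qy <-] [q' /= q'z]]].
move=> /esym/cover_inverse_eq[n En]; apply: CD.
have zy : z = y + b n by rewrite -q'z En act /= qy.
rewrite eqEsubset; split => _ [x /= xy <-].
  exists (heis_act (hol n) x); first by rewrite act /= xy zy.
  by apply/esym/cover_inverse_eq; exists n.
exists (x.1 - k * b n * y - c n, y) => //.
apply/cover_inverse_eq; exists n; rewrite act /= [x]surjective_pairing xy zy.
by congr pair; ring.
Qed.

End Shear.

(** * Holonomy by translations *)

Section Translations.
Variable tau : int * int -> R * R.
Hypothesis act : forall n p, heis_act (hol n) p = p + tau n.

Lemma tau_add m n : tau (m + n) = tau m + tau n.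
Proof.
have [Hhol add _] := holM.
have := heis_act_mul (hol m) 0 (Hhol n).
by rewrite -add !act !add0r [tau n + _]addrC.
Qed.

Lemma additive_int (f : int -> R * R) (i : int) : (forall i j, f (i + j) = f i + f j) ->
  f i = (i%:~R : R) *: f 1.
Proof.
move=> fD.
have f0 : f 0 = 0 by apply: (addrI (f 0)); rewrite -fD !addr0.
have fn (n : nat) : f n%:Z = (n%:R : R) *: f 1.
  elim: n => [|n IHn]; first by rewrite f0 scale0r.
  by rewrite -natr1 scalerDl scale1r -IHn -fD; congr f; lia.
case: i => n; first exact: fn.
rewrite NegzE mulrNz scaleNr -fn.
by apply: (addrI (f n.+1%:Z)); rewrite -fD !subrr f0.
Qed.

Let t1 := tau (1, 0).
Let t2 := tau (0, 1).

Lemma tauE i j : tau (i, j) = (i%:~R : R) *: t1 + (j%:~R : R) *: t2.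
Proof.
have -> : (i, j) = (i, 0) + (0, j) :> (int * int)%type by congr pair => /=; rewrite ?addr0 ?add0r.
rewrite tau_add (@additive_int (fun i => tau (i, 0)) i); last first.
  by move=> x y; rewrite -tau_add; congr tau; congr pair => /=; rewrite addr0.
rewrite (@additive_int (fun j => tau (0, j)) j)//.
by move=> x y; rewrite -tau_add; congr tau; congr pair => /=; rewrite addr0.
Qed.

(** A linear functional that kills both generators would be periodic along
    [dev]. *)
Lemma tau_independent : t1.1 * t2.2 - t1.2 * t2.1 != 0.
Proof.
apply/eqP => det0.
have [_ _ eqv] := holM.
have key (u v : R) : (u, v) <> 0 -> u * t1.1 + v * t1.2 = 0 -> u * t2.1 + v * t2.2 = 0 -> False.
  move=> uv0 e1 e2; apply: (no_periodic_functional devM (w := 0) uv0).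
  move=> [i j] p; rewrite eqv act tauE /= /GRing.scale/=; congr (`|_|).
  rewrite -[RHS]addr0 -[X in _ = _ + X](mulr0 i%:~R) -e1 -[LHS]addr0.
  by rewrite -[X in _ + X = _](mulr0 (- j%:~R)) -e2; ring.
have [t10|/eqP t10] := eqVneq t1 0; last first.
  apply: (key (- t1.2) t1.1); [|by ring|by rewrite -det0; ring].
  by move=> [/eqP]; rewrite oppr_eq0 => /eqP a c; apply: t10; rewrite [t1]surjective_pairing a c.
have [t20|/eqP t20] := eqVneq t2 0.
  apply: (key 1 0); rewrite ?t10 ?t20 ?mulr0 ?addr0//.
  by case=> /eqP; rewrite oner_eq0.
apply: (key (- t2.2) t2.1); [|by rewrite t10 !mulr0 addr0|by ring].
by move=> [/eqP]; rewrite oppr_eq0 => /eqP a c; apply: t20; rewrite [t2]surjective_pairing a c.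
Qed.

Lemma lattice_coordinates (u v : R) y n : y + u *: t1 + v *: t2 = heis_act (hol n) y ->
  u = n.1%:~R /\ v = n.2%:~R.
Proof.
case: n => i j; rewrite act tauE -addrA => /addrI.
have det := tau_independent.
move=> H; have := congr1 fst H; have := congr1 snd H; rewrite /= /GRing.scale/= => e2 e1.
split; apply: (mulIf det).
  have -> : u * (t1.1 * t2.2 - t1.2 * t2.1) =
    (u * t1.1 + v * t2.1) * t2.2 - (u * t1.2 + v * t2.2) * t2.1 by ring.
  by rewrite e1 e2; ring.
have -> : v * (t1.1 * t2.2 - t1.2 * t2.1) =
    (u * t1.2 + v * t2.2) * t1.1 - (u * t1.1 + v * t2.1) * t1.2 by ring.
by rewrite e1 e2; ring.
Qed.

(** The last hypothesis says that [v] is primitive: the multiples of [v] that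
    are translations of the holonomy are integral, so one turn is injective. *)
Lemma closed_geodesic (v : R * R) n : v = tau n -> v <> 0 ->
  (forall (x : R) m, 0 + x *: v = heis_act (hol m) 0 -> exists i : int, x = i%:~R) ->
  simple_geodesic M (straight 0 v @` setT).
Proof.
move=> vn v0 prim; exists setT, (straight 0 v); split => //.
  exact: straight_maximal.
right; split => //; exists 1; split => // [t|s t].
  apply/esym/cover_inverse_eq; exists n.
  by rewrite act -vn scalerDl scale1r addrA.
rewrite !inE /= !in_itv /= => /andP[s0 s1] /andP[t0_ t1_] /cover_inverse_eq[m].
rewrite !act !add0r => Em.
have [|i Hi] := prim (t - s) m.
  by rewrite act !add0r scalerBl Em addrC addKr.
have : (-1)%:~R < i%:~R :> R by rewrite -Hi mulrN1z; lra.
have : i%:~R < 1%:~R :> R by rewrite -Hi; lra.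
rewrite !ltr_int => i1 i2; have i0 : i = 0 by lia.
by move: Hi; rewrite i0 => /eqP; rewrite subr_eq0 => /eqP.
Qed.

(** Both closed geodesics pass through the projection of the origin, but the
    midpoint of the second generator is on no translate of the first axis. *)
Lemma crossing_geodesics : exists C D, [/\ simple_geodesic M C, simple_geodesic M D,
  C <> D & C `&` D !=set0].
Proof.
have det := tau_independent.
exists (straight 0 t1 @` setT), (straight 0 t2 @` setT); split.
- apply: (@closed_geodesic _ (1, 0)) => // [t10|x m].
    by move: det; rewrite t10 !mul0r subrr eqxx.
  rewrite -[_ + _]addr0 -[X in _ + X](scale0r t2) => /lattice_coordinates[-> _].
  by exists m.1.
- apply: (@closed_geodesic _ (0, 1)) => // [t20|x m].
    by move: det; rewrite t20 !mulr0 subrr eqxx.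
  have -> : 0 + x *: t2 = 0 + (0 : R) *: t1 + x *: t2 by rewrite scale0r addr0.
  move=> /lattice_coordinates[_ ->].
  by exists m.2.
- move=> CD; have : (straight 0 t2 @` setT) (straight 0 t2 2^-1) by exists 2^-1.
  rewrite -CD => -[s _ /cover_inverse_eq[n]].
  rewrite act !add0r => H.
  have [|_] := @lattice_coordinates (- s) 2^-1 0 n.
    by rewrite act !add0r H scaleNr addKr.
  move=> e; have : (2 * n.2)%:~R = 1%:~R :> R.
    by rewrite intrM -e mulfV ?pnatr_eq0.
  by move=> /intr_inj; lia.
- exists (straight 0 t1 0); split; exists 0 => //.
  by rewrite /straight !scale0r.
Qed.

End Translations.

End Geodesics.

(** * The characterization *)

Theorem mainTheorem8 (R : realType) (T : topologicalType)
    (M : heis_torus R T) :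
  holonomy_contains_shear M <->
  (forall C D : set T, simple_geodesic M C -> simple_geodesic M D ->
     C <> D -> C `&` D = set0).
Proof.
split.
  move=> [dev [hol [devM holM [n shear]]]] C D.
  have [injdev surjdev] := dev_bijective devM holM.
  have [E devE] := boolp.choice surjdev.
  have Edev : cancel dev E by move=> p; apply: injdev; rewrite devE.
  have [k [b [c [act b0]]]] := holonomy_shape devM holM.
  apply: (simple_geodesics_disjoint devM holM devE Edev act) => //.
  apply/eqP => k0; apply: shear; exists (c n, b n) => p.
  by rewrite act k0 !mul0r addr0.
move=> disj; apply: contrapT => noshear.
have [dev devM] := developing_exists M.
have [hol holM] := holonomy_exists devM.
have translation n : exists v, forall p, heis_act (hol n) p = p + v.
  by apply: contrapT => shear; apply: noshear; exists dev, hol; split => //; exists n.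
have [tau act] := boolp.choice translation.
have [injdev surjdev] := dev_bijective devM holM.
have [E devE] := boolp.choice surjdev.
have Edev : cancel dev E by move=> p; apply: injdev; rewrite devE.
have [C [D [sC sD CD [x CDx]]]] := crossing_geodesics devM holM devE Edev act.
by have := disj C D sC sD CD; move: CDx => /[swap] ->.
Qed.
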